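(* Let $n\ge 2$ and let $P\in[0,1]^{n\times n}$ be the transition matrix of an irreducible Markov chain on $[n]=\{1,\dots,n\}$, with stationary distribution $\pi$. Let $L_{\mathrm{kill}}=I_{n^2}-(P\otimes P)E$ have singular values (with multiplicities) $\widetilde\sigma_1\ge\dots\ge\widetilde\sigma_{n^2}>0$ (strict positivity being part of the setting), with corresponding left and right singular vectors $\widetilde u_i,\widetilde v_i$. For $k\in\{1,\dots,n^2-1\}$ define $$\hat t^{\,\pi,(k)}_{\mathrm{meet}} := -1+\sum_{i=n^2-k+1}^{n^2}\frac{1}{\widetilde\sigma_i}(\pi\otimes\pi)^t\,\widetilde v_i\,\widetilde u_i^{\,t}\,\mathbf{1}_{n^2}.$$ Then $$\big|\hat t^{\,\pi,(k)}_{\mathrm{meet}}-t^{\pi}_{\mathrm{meet}}\big|\le\frac{n\|\pi\|^2}{\widetilde\sigma_{n^2-k}} ,$$ where $\|\cdot\|$ is the Euclidean norm.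
   Context: Vectors in $\mathbb{R}^{n^2}$ and $n^2\times n^2$ matrices are indexed by pairs $(k,\ell)\in[n]^2$ via the identification $(k,\ell)\mapsto (k-1)n+\ell\in[n^2]$. The Kronecker product satisfies $(P\otimes P)_{(i,j),(k,\ell)}=P_{ik}P_{j\ell}$, and $(\pi\otimes\pi)_{(i,j)}=\pi_i\pi_j$. $I_{n^2}$ is the identity matrix, and $\mathbf{1}_{n^2}$ is the vector with all $n^2$ coordinates equal to $1$. The matrix $E\in\{0,1\}^{n^2\times n^2}$ is the diagonal matrix $E_{(i,j),(k,\ell)}=\mathbb{1}\{(i,j)=(k,\ell)\}\,\mathbb{1}\{k\ne\ell\}$. Singular vectors are taken from a singular value decomposition $L_{\mathrm{kill}}=\widetilde U\widetilde\Sigma\widetilde V^t$ with $\widetilde U,\widetilde V$ orthogonal with columns $\widetilde u_i$ and $\widetilde v_i$, and $\widetilde\Sigma=\operatorname{diag}(\widetilde\sigma_1,\dots,\widetilde\sigma_{n^2})$. Meeting time: let $(X_t)_{t\ge0}$, $(Y_t)_{t\ge0}$ be independent discrete-time Markov chains on $[n]$, both with transition matrix $P$, with $X_0=i$, $Y_0=j$. Then $\tau_{\mathrm{meet}}(i,j)=\inf\{t\in\mathbb{Z}_{\ge0}:X_t=Y_t\}$ ($=\infty$ if they never meet), and $t^{\pi}_{\mathrm{meet}}=\sum_{i,j\in[n]}\pi_i\pi_j\,\mathbf{E}[\tau_{\mathrm{meet}}(i,j)]$. *)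

(* Defs.v *)
From mathcomp Require Import all_boot all_order all_algebra.
From mathcomp Require Import mxtens.
From mathcomp Require Import all_classical all_reals all_analysis.

Set Implicit Arguments.
Unset Strict Implicit.
Unset Printing Implicit Defensive.

Import Order.TTheory GRing.Theory Num.Theory.

Local Open Scope classical_set_scope.
Local Open Scope ring_scope.

Definition stochastic (R : realType) (n : nat) (P : 'M[R]_n) : Prop :=
  (forall i j, 0 <= P i j <= 1) /\ (forall i, \sum_j P i j = 1).

Definition irreducible_chain (R : realType) (n : nat) (P : 'M[R]_n) : Prop :=
  forall i j, exists t : nat, 0 < (P ^+ t) i j.

Definition stationary (R : realType) (n : nat) (P : 'M[R]_n) (pi : 'cV[R]_n) :
    Prop :=
  [/\ forall i, 0 <= pi i 0, \sum_i pi i 0 = 1 & pi^T *m P = pi^T].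

Definition enorm (R : realType) (n : nat) (v : 'cV[R]_n) : R :=
  Num.sqrt (\sum_i v i 0 ^+ 2).

(* Pairs of states are encoded by [mxtens_index], whose value at [(k, l)] is
   [k * n + l]; this is the indexing of the Kronecker product [_ *t _]. *)
Definition offdiag_mx (R : realType) (n : nat) : 'M[R]_(n * n) :=
  \matrix_(a, b) ((a == b) &&
    ((mxtens_unindex b).1 != (mxtens_unindex b).2))%:R.

Definition Lkill (R : realType) (n : nat) (P : 'M[R]_n) : 'M[R]_(n * n) :=
  1%:M - (P *t P) *m offdiag_mx R n.

Definition orthogonal_mx (R : realType) (m : nat) (U : 'M[R]_m) : Prop :=
  U^T *m U = 1%:M /\ U *m U^T = 1%:M.

(* [sigma 0 i] is the (i+1)-st largest singular value, with left and right
   singular vectors [col i U] and [col i V]. *)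
Definition is_svd (R : realType) (m : nat) (A U : 'M[R]_m) (sigma : 'rV[R]_m)
    (V : 'M[R]_m) : Prop :=
  [/\ orthogonal_mx U, orthogonal_mx V,
      forall i, 0 <= sigma 0 i,
      forall i j : 'I_m, (i <= j)%N -> sigma 0 j <= sigma 0 i &
      A = U *m diag_mx sigma *m V^T].

Section Processes.
Context {d : measure_display} {T : measurableType d} {R : realType}.
Context (Pr : probability T R) {n : nat}.
Implicit Types X Y : nat -> T -> 'I_n.

Definition history X (x : nat -> 'I_n) (t : nat) : set T :=
  [set w | forall s, (s <= t)%N -> X s w = x s].

(* The Markov property, with the conditional probability given a history of
   positive probability multiplied out. *)
Definition markov_chain (P : 'M[R]_n) (i : 'I_n) X : Prop :=
  [/\ forall t x, measurable [set w | X t w = x],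
      Pr [set w | X 0%N w = i] = 1%E &
      forall (t : nat) (x : nat -> 'I_n) (y : 'I_n),
        (0 < Pr (history X x t))%E ->
        Pr (history X x t `&` [set w | X t.+1 w = y]) =
          (Pr (history X x t) * (P (x t) y)%:E)%E].

Definition sigma_process X : set (set T) :=
  <<s [set A | exists t x, A = [set w | X t w = x]] >>.

Definition independent_processes X Y : Prop :=
  forall A B, sigma_process X A -> sigma_process Y B ->
    Pr (A `&` B) = (Pr A * Pr B)%E.

(* The infimum of the empty set is [+oo]. *)
Definition meeting_time X Y (w : T) : \bar R :=
  ereal_inf [set t%:R%:E | t in [set t : nat | X t w = Y t w]].

End Processes.

(* A realization, on some probability space, of two independent chains with
   transition matrix [P] started at [i] and [j]. *)
Record chain_pair (R : realType) (n : nat) (P : 'M[R]_n) (i j : 'I_n) :=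
  ChainPair {
    cp_disp : measure_display;
    cp_space : measurableType cp_disp;
    cp_prob : probability cp_space R;
    cp_X : nat -> cp_space -> 'I_n;
    cp_Y : nat -> cp_space -> 'I_n;
    cp_markovX : markov_chain cp_prob P i cp_X;
    cp_markovY : markov_chain cp_prob P j cp_Y;
    cp_indep : independent_processes cp_prob cp_X cp_Y }.

Arguments cp_prob {R n P i j} c : rename.
Arguments cp_X {R n P i j} c t w : rename.
Arguments cp_Y {R n P i j} c t w : rename.

Definition mean_meeting_time (R : realType) (n : nat) (P : 'M[R]_n)
    (i j : 'I_n) (C : chain_pair P i j) : \bar R :=
  (\int[cp_prob C]_w meeting_time (cp_X C) (cp_Y C) w)%E.

Definition t_meet (R : realType) (n : nat) (P : 'M[R]_n) (pi : 'cV[R]_n)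
    (C : forall i j, chain_pair P i j) : \bar R :=
  (\sum_i \sum_j (pi i 0 * pi j 0)%:E * mean_meeting_time (C i j))%E.

(* The k smallest singular values, i.e. the 1-based indices
   n^2-k+1, ..., n^2, are the ordinals [i] with [n * n - k <= i]. *)
Definition t_meet_hat (R : realType) (n : nat) (pi : 'cV[R]_n)
    (U : 'M[R]_(n * n)) (sigma : 'rV[R]_(n * n)) (V : 'M[R]_(n * n))
    (k : nat) : R :=
  -1 + \sum_(i < n * n | (n * n - k <= i)%N)
    (sigma 0 i)^-1 *
    ((pi *t pi)^T *m col i V *m (col i U)^T *m (const_mx 1 : 'cV[R]_(n * n)))
      0 0.

(* Main.v *)
Require Import Defs.
From mathcomp Require Import all_boot all_order all_algebra.
From mathcomp Require Import mxtens ring.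
From mathcomp Require Import all_classical all_reals all_analysis.

(** Let [A = (P (x) P) E], so that [Lkill P = 1 - A], and let [1] also denote the
all-ones vector. The stationary meeting time is, up to a constant, a value of
the bilinear form of [Lkill^-1], of which the estimate keeps only the terms with
the smallest singular values.

Meeting times. The entry of [A ^ t 1] at [(i, j)] is the probability that chains
started at [i] and [j] do not meet at any of the times [1, ..., t]
([joint_apart]). Since [tau] is the sum over [t] of the indicators of [tau > t],
its mean is the sum over [t] of [1{i <> j} (A ^ t 1)(i, j)]
([expectation_meeting_time], [probability_apart]).

Summing the series. [A] is substochastic, so [A ^ t 1] decreases to a limit
fixed by [A]; as [1 - A] is invertible, this limit is [0], and the telescoped
series [sum_t A ^ t 1] is [Lkill^-1 1] ([survival_series_cvg]). Hence the mean
meeting time from [(i, j)] is [(E Lkill^-1 1)(i, j)]. By stationarity of [pi (x) pi] under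
[P (x) P], the row [rho^T] of [rho = pi (x) pi] satisfies
[rho^T Lkill = rho^T - rho^T E], and applying both sides to [Lkill^-1 1] gives
[t_meet = -1 + rho^T Lkill^-1 1] ([t_meetE]).

Truncation. Writing [Lkill^-1 = sum_i sigma_i^-1 v_i u_i^T], the error is the
sum over the [n^2 - k] largest singular values only. There [sigma_i^-1] is at
most [1 / sigma_(n^2 - k)], and by Cauchy-Schwarz and orthogonality the
remaining factors sum to at most [|rho| |1| = |pi|^2 n]
([is_svd_head_bound]). *)

Import Order.TTheory GRing.Theory Num.Theory.
Import numFieldNormedType.Exports.

Set Implicit Arguments.
Unset Strict Implicit.
Unset Printing Implicit Defensive.

Local Open Scope classical_set_scope.
Local Open Scope ring_scope.

(** * Resolvents of substochastic matrices *)

(** For a substochastic [A], the entry at [a] is the probability that the chain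
killed according to [A] and started at [a] is still alive after [t] steps. *)
Definition survival (R : realType) (m : nat) (A : 'M[R]_m) (t : nat) :
    'cV[R]_m :=
  iter t (mulmx A) (const_mx 1).

Lemma survivalS (R : realType) (m : nat) (A : 'M[R]_m) t :
  survival A t.+1 = A *m survival A t.
Proof. by []. Qed.

Lemma cvg_mulmx_col (R : realType) (p m : nat) (B : 'M[R]_(p, m))
    (u : nat -> 'cV[R]_m) (l : 'cV[R]_m) :
  (forall a, u t a 0 @[t --> \oo] --> l a 0) ->
  forall a, (B *m u t) a 0 @[t --> \oo] --> (B *m l) a 0.
Proof.
move=> ul a; rewrite mxE; under eq_fun do rewrite mxE.
by apply: cvg_big => [|b _]; [exact: add_continuous|apply: cvgMr].
Qed.

Section Resolvent.
Context (R : realType) (m : nat) (A : 'M[R]_m).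
Context (A_ge0 : forall a b, 0 <= A a b) (A_le1 : forall a, \sum_b A a b <= 1).
Context (A_unit : 1%:M - A \in unitmx).

Lemma survival_ge0 t a : 0 <= survival A t a 0.
Proof.
elim: t a => [|t IH] a; first by rewrite mxE.
by rewrite survivalS mxE sumr_ge0// => b _; rewrite mulr_ge0.
Qed.

Lemma survival_nonincreasing a :
  {homo (fun t => survival A t a 0) : s t / (s <= t)%N >-> t <= s}.
Proof.
apply: homo_leq => [//|x y z xy yz|t]; first exact: le_trans yz xy.
elim: t a => [|t IH] a.
  rewrite survivalS !mxE (le_trans _ (A_le1 a))// ler_sum// => b _.
  by rewrite mxE mulr1.
rewrite survivalS (survivalS A t) !mxE.
by apply: ler_sum => b _; rewrite ler_wpM2l.
Qed.

Lemma survival_is_cvg a : cvgn (fun t => survival A t a 0).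
Proof.
apply: nonincreasing_is_cvgn; first exact: survival_nonincreasing.
by exists 0 => _ [t _ <-]; exact: survival_ge0.
Qed.

(** The entrywise limit exists by monotonicity and is fixed by [A], hence lies in
the trivial kernel of [1%:M - A]. *)
Lemma survival_cvg0 a : survival A t a 0 @[t --> \oo] --> (0 : R).
Proof.
pose l : 'cV[R]_m := \col_b limn (fun t => survival A t b 0).
have fl b : survival A t b 0 @[t --> \oo] --> l b 0.
  by rewrite mxE; exact: survival_is_cvg.
suff l0 : l = 0 by have := fl a; rewrite l0 mxE.
have Al : A *m l = l.
  apply/matrixP => b j; rewrite ord1.
  have Afl : (A *m survival A t) b 0 @[t --> \oo] --> (A *m l) b 0.
    exact: cvg_mulmx_col.
  rewrite -(cvg_lim _ Afl)//; apply/cvg_lim => //.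
  by have := fl b; rewrite -cvg_shiftS.
rewrite -[l](mulKmx A_unit) mulmxBl mul1mx Al subrr.
by rewrite mulmx0.
Qed.

(** Multiplying a partial sum by [1%:M - A] telescopes it to
[const_mx 1 - survival A N], whose second term vanishes in the limit. *)
Lemma survival_series_cvg a :
  series (fun t => survival A t a 0) t @[t --> \oo] -->
  (invmx (1%:M - A) *m const_mx 1 : 'cV[R]_m) a 0.
Proof.
have sumE N : \sum_(0 <= t < N) survival A t =
    invmx (1%:M - A) *m (const_mx 1 - survival A N).
  rewrite -[LHS](mulKmx A_unit); congr (_ *m _).
  rewrite mulmx_sumr (eq_bigr (fun t => - (survival A t.+1 - survival A t))).
    by rewrite sumrN telescope_sumr// opprB.
  by move=> t _; rewrite mulmxBl mul1mx opprB.
rewrite (_ : series _ = fun N =>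
    (invmx (1%:M - A) *m (const_mx 1 - survival A N)) a 0); last first.
  by apply/funext => N; rewrite -sumE summxE.
apply: cvg_mulmx_col => b; under eq_fun do rewrite !mxE.
have -> : (const_mx 1 : 'cV[R]_m) b 0 = 1 - 0 by rewrite subr0 mxE.
by apply: cvgB; [exact: cvg_cst|exact: survival_cvg0].
Qed.

Lemma survival_nneseries a :
  (\sum_(t <oo) (survival A t a 0)%:E =
   ((invmx (1%:M - A) *m const_mx 1 : 'cV[R]_m) a 0)%:E)%E.
Proof.
apply/cvg_lim => //; under eq_fun do rewrite sumEFin.
by apply: cvg_EFin; [exact: nearW|exact: survival_series_cvg].
Qed.

End Resolvent.

(** * The chain of pairs killed on the diagonal *)

Definition killed (R : realType) (n : nat) (P : 'M[R]_n) : 'M[R]_(n * n) :=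
  (P *t P) *m offdiag_mx R n.

Lemma sum_mxtens_index (R : nmodType) (n : nat) (F : 'I_(n * n) -> R) :
  \sum_a F a = \sum_i \sum_j F (mxtens_index (i, j)).
Proof.
rewrite pair_big (reindex (@mxtens_index n n)) /=.
  by apply: eq_bigr => -[].
by exists (@mxtens_unindex n n) => x _; rewrite (mxtens_indexK, mxtens_unindexK).
Qed.

Lemma killedE (R : realType) (n : nat) (P : 'M[R]_n) a i j :
  killed P a (mxtens_index (i, j)) =
    P (mxtens_unindex a).1 i * P (mxtens_unindex a).2 j * (i != j)%:R.
Proof.
rewrite mxE (bigD1 (mxtens_index (i, j)))//= big1 ?addr0 => [|b bij].
  by rewrite !mxE eqxx mxtens_indexK.
by rewrite !mxE (negPf bij) mulr0.
Qed.

Lemma survival_killedS (R : realType) (n : nat) (P : 'M[R]_n) t i j :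
  survival (killed P) t.+1 (mxtens_index (i, j)) 0 =
  \sum_k \sum_l P i k * P j l *
    ((k != l)%:R * survival (killed P) t (mxtens_index (k, l)) 0).
Proof.
rewrite survivalS mxE sum_mxtens_index; apply: eq_bigr => k _.
by apply: eq_bigr => l _; rewrite killedE mxtens_indexK mulrA.
Qed.

(** * The law of the first meeting of two independent chains *)

Section Probability.
Context {d : measure_display} {T : measurableType d} {R : realType}.
Context (Pr : probability T R) {n : nat}.

Lemma probability_setI_full (A B : set T) :
  measurable A -> measurable B -> Pr B = 1%E -> Pr (A `&` B) = Pr A.
Proof.
move=> mA mB PB; have PD : Pr (A `\` B) = 0%E; last first.
  by rewrite -[LHS]add0e -PD; exact/esym/measureDI.
apply: (@subset_measure0 _ _ _ Pr _ (~` B)) => //.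
- exact: measurableD.
- exact: measurableC.
- by apply: (etrans (probability_setC Pr mB)); rewrite PB subee.
Qed.

Lemma measure_total (Z : T -> 'I_n) (A : set T) :
  (forall i, measurable [set w | Z w = i]) -> measurable A ->
  Pr A = (\sum_i Pr (A `&` [set w | Z w = i]))%E.
Proof.
move=> mZ mA; rewrite -(@measure_bigsetU_ord _ _ _ _ n predT); last 2 first.
- by move=> i; exact: measurableI.
- apply/trivIsetP => i j _ _ /eqP ij.
  by apply/seteqP; split=> // w [[_ /= Zi] [_ /= Zj]]; apply: ij; rewrite -Zi.
congr (Pr _); apply/seteqP; split=> [w Aw|w].
  by rewrite -bigcup_seq; exists (Z w) => //=; rewrite mem_index_enum.
by rewrite -bigcup_seq => -[i _ []].
Qed.

Implicit Types (X Y : nat -> T -> 'I_n) (x y : nat -> 'I_n).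

Lemma history0 X x : history X x 0 = [set w | X 0%N w = x 0%N].
Proof.
apply/seteqP; split=> [w /(_ 0%N)|w Xw s]; first exact.
by rewrite leqn0 => /eqP ->.
Qed.

Lemma historyS X x t :
  history X x t.+1 = history X x t `&` [set w | X t.+1 w = x t.+1].
Proof.
apply/seteqP; split=> [w H|w [H Xw] s].
  by split=> [s st|/=]; apply: H => //; exact: leqW.
by rewrite leq_eqVlt => /orP[/eqP ->//|]; exact: H.
Qed.

Lemma eq_history X x y t :
  (forall s, (s <= t)%N -> x s = y s) -> history X x t = history X y t.
Proof.
by move=> xy; apply/seteqP; split=> w H s st; rewrite H// xy.
Qed.

(** Turns a prescribed path up to time [t] into one up to time [t.+1] that takes
the value [c] at the new time. *)
Definition extend x t c s := if (s <= t)%N then x s else c.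

Lemma history_extend X x t c :
  history X (extend x t c) t.+1 = history X x t `&` [set w | X t.+1 w = c].
Proof.
rewrite historyS {2}/extend ltnn (@eq_history _ _ x)// => s st.
by rewrite /extend st.
Qed.

Lemma sigma_process_history X x t : sigma_process X (history X x t).
Proof.
have gen s : sigma_process X [set w | X s w = x s].
  by apply: sub_gen_smallest; exists s, (x s).
elim: t => [|t IH]; first by rewrite history0.
rewrite historyS.
pose G := [set A | exists t c, A = [set w | X t w = c]].
exact: (@measurableI _ (g_sigma_algebraType G) _ _ IH (gen t.+1)).
Qed.

Lemma measurable_history X x t :
  (forall t c, measurable [set w | X t w = c]) -> measurable (history X x t).
Proof.
move=> mX; elim: t => [|t IH]; first by rewrite history0.
by rewrite historyS; exact: measurableI.
Qed.

(** When the history has probability zero, where the Markov property gives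
nothing, both sides vanish. *)
Lemma markov_step P i X x t c : markov_chain Pr P i X ->
  Pr (history X (extend x t c) t.+1) = (Pr (history X x t) * (P (x t) c)%:E)%E.
Proof.
move=> [mX _ XP]; rewrite history_extend.
have mH := measurable_history x t mX.
have [H0|H0] := eqVneq (Pr (history X x t)) 0%E; last first.
  by apply: XP; rewrite lt0e H0/=.
rewrite H0 mul0e; apply: (subset_measure0 _ mH _ H0) => [|w []//].
exact: measurableI.
Qed.

(** The window is half-open: the event that the meeting time exceeds [t] is
[apart X Y 0 t.+1]. *)
Definition apart X Y (s t : nat) : set T :=
  [set w | forall r, (s <= r < t)%N -> X r w <> Y r w].

Lemma measurable_meet X Y r :
  (forall t c, measurable [set w | X t w = c]) ->
  (forall t c, measurable [set w | Y t w = c]) ->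
  measurable [set w | X r w = Y r w].
Proof.
move=> mX mY.
rewrite (_ : [set _ | _] =
    \bigcup_(i in [set: 'I_n]) ([set w | X r w = i] `&` [set w | Y r w = i])).
  by apply: fin_bigcup_measurable => // i _; exact: measurableI.
by apply/seteqP; split=> [w /= XY|w [i _ [/= -> ->]]//]; exists (X r w).
Qed.

Lemma measurable_apart X Y s t :
  (forall t c, measurable [set w | X t w = c]) ->
  (forall t c, measurable [set w | Y t w = c]) ->
  measurable (apart X Y s t).
Proof.
move=> mX mY.
rewrite (_ : apart _ _ _ _ =
    \bigcap_(r in [set r | (s <= r < t)%N]) ~` [set w | X r w = Y r w]).
  by apply: bigcap_measurableType => r _; exact/measurableC/measurable_meet.
by apply/seteqP; split.
Qed.

Lemma apart_split X Y s t : (s < t)%N ->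
  apart X Y s t = [set w | X s w <> Y s w] `&` apart X Y s.+1 t.
Proof.
move=> st; apply/seteqP; split=> [w H|w [XY H] r].
  split=> [|r /andP[sr rt]]; first by apply: H; rewrite leqnn.
  by apply: H; rewrite rt (ltnW sr).
by case/andP; rewrite leq_eqVlt => /orP[/eqP <-//|sr rt]; apply: H; rewrite sr.
Qed.

Section Pair.
Context (P : 'M[R]_n) (i j : 'I_n) (X Y : nat -> T -> 'I_n).
Context (hX : markov_chain Pr P i X) (hY : markov_chain Pr P j Y).
Context (XY : independent_processes Pr X Y).

Let mX t c : measurable [set w | X t w = c]. Proof. by case: hX. Qed.
Let mY t c : measurable [set w | Y t w = c]. Proof. by case: hY. Qed.

(** Conditioning on whole histories of both chains lets independence and the two
Markov properties be applied separately, and turns the joint Markov property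
into an induction on [m]: splitting according to the states [k], [l] at time
[t.+1], the cases [k = l] are impossible, and the others are instances of the
induction hypothesis for the histories extended by [k] and [l], weighted by
[P (x t) k * P (y t) l]. This is the recursion defining [survival]. *)
Lemma joint_apart m t x y :
  Pr (history X x t `&` history Y y t `&` apart X Y t.+1 (t.+1 + m)) =
  (Pr (history X x t) * Pr (history Y y t) *
    (survival (killed P) m (mxtens_index (x t, y t)) 0)%:E)%E.
Proof.
elim: m t x y => [|m IH] t x y.
  rewrite mxE mule1 -XY; [|exact: sigma_process_history..].
  congr (Pr _); rewrite addn0; apply/seteqP; split=> [w []//|w H]; split=> //.
  by move=> r /andP[tr]; rewrite ltnNge tr.
set H := _ `&` _ `&` _.
have mH : measurable H.
  apply: measurableI; first by apply: measurableI; exact: measurable_history.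
  exact: measurable_apart.
rewrite (measure_total (Z := X t.+1))// survival_killedS.
(* The probabilities of the histories are finite, so one can compute in [R]. *)
have [p Hp] : exists p : R, Pr (history X x t) = p%:E.
  exists (fine (Pr (history X x t))).
  by rewrite fineK// fin_num_measure//; exact: measurable_history.
have [q Hq] : exists q : R, Pr (history Y y t) = q%:E.
  exists (fine (Pr (history Y y t))).
  by rewrite fineK// fin_num_measure//; exact: measurable_history.
rewrite Hp Hq -!EFinM mulr_sumr -sumEFin; apply: eq_bigr => k _.
have mHk : measurable (H `&` [set w | X t.+1 w = k]) by exact: measurableI.
rewrite (measure_total (Z := Y t.+1))// mulr_sumr -sumEFin.
apply: eq_bigr => l _.
have [<-|kl] := eqVneq k l.
  rewrite mul0r !mulr0 (_ : _ `&` _ = set0) ?measure0//.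
  apply/seteqP; split=> // w [[[_ H'] /= Xk] /= Yl].
  by have := H' t.+1; rewrite Xk Yl leqnn addSn ltnS addnS ltnS leq_addr => /(_ isT).
rewrite mul1r; have := IH t.+1 (extend x t k) (extend y t l).
rewrite !(markov_step _ _ _ hX, markov_step _ _ _ hY) Hp Hq.
rewrite {3 4}/extend ltnn -!EFinM => E.
rewrite mulrA [p * q * _]mulrACA -E !history_extend; congr (Pr _).
rewrite /H apart_split ?addSn ?ltnS ?addnS ?leq_addr//.
apply/seteqP; split=> w /=; first by move=> [[[[? ?] [? ?]] ?] ?].
by move=> [[[? Xk] [? Yl]] ?]; do !split => //; rewrite Xk Yl; exact/eqP.
Qed.

(** The histories at time [0] have full probability; they decide whether the
chains meet at time [0], which accounts for the factor [i != j]. *)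
Lemma probability_apart t :
  Pr (apart X Y 0 t.+1) =
  ((i != j)%:R * survival (killed P) t (mxtens_index (i, j)) 0)%:E.
Proof.
pose H := history X (fun=> i) 0 `&` history Y (fun=> j) 0.
have mH : measurable H by apply: measurableI; exact: measurable_history.
have PX : Pr (history X (fun=> i) 0) = 1%E by rewrite history0; case: hX.
have PY : Pr (history Y (fun=> j) 0) = 1%E by rewrite history0; case: hY.
have PH : Pr H = 1%E.
  by rewrite XY ?PX ?PY ?mule1//; exact: sigma_process_history.
rewrite -(probability_setI_full (measurable_apart _ _ mX mY) mH PH) setIC.
rewrite apart_split// /H !history0.
have [ij|ij] := eqVneq i j.
  rewrite mul0r (_ : _ `&` _ = set0) ?measure0//.
  by apply/seteqP; split=> // w [[/= -> ->] [+ _]]; rewrite ij.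
have := joint_apart t 0 (fun=> i) (fun=> j).
rewrite PX PY !mul1e add1n mul1r => <-; rewrite !history0.
congr (Pr _); apply/seteqP; split=> w /=; first by move=> [? [? ?]].
by move=> [[Xi Yj] ?]; do !split => //; rewrite Xi Yj; exact/eqP.
Qed.

(** The series counts the times before the first meeting, and diverges when the
chains never meet, in agreement with an infimum over the empty set. *)
Lemma meeting_time_nneseries w :
  meeting_time X Y w = (\sum_(t <oo) (\1_(apart X Y 0 t.+1) w)%:E)%E :> \bar R.
Proof.
have [met|never] := pselect (exists t, X t w == Y t w).
  have [m /eqP Em min_m] := ex_minnP met.
  rewrite (nneseries_split 0 m)// [X in (_ + X)%E]eseries0 ?adde0; last first.
    move=> t mt _; rewrite indicE memNset// => /(_ m).
    by rewrite ltnS -[(m <= t)%N]/(0 + m <= t)%N mt; apply.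
  rewrite add0n (eq_big_nat _ _ (F2 := fun=> 1%E)); last first.
    move=> t tm; rewrite indicE mem_set// => r /=; rewrite ltnS => rt /eqP/min_m.
    by rewrite leqNgt (leq_ltn_trans rt).
  rewrite sumEFin sumr_const_nat subn0; apply/eqP; rewrite eq_le; apply/andP; split.
    by apply: ereal_inf_lbound; exists m.
  apply: le_ereal_inf_tmp => _ [t /= /eqP/min_m mt <-].
  by rewrite lee_fin ler_nat.
rewrite /meeting_time (_ : [set t%:R%:E | t in _] = set0); last first.
  by apply/seteqP; split=> // _ [t /= /eqP XYt _]; apply: never; exists t.
rewrite ereal_inf0; apply/esym.
have -> : (fun N => \sum_(0 <= t < N) (\1_(apart X Y 0 t.+1) w)%:E)%E =
    (fun N => (N%:R%:E : \bar R)).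
  apply/funext => N; rewrite sumEFin (eq_bigr (fun=> 1)).
    by rewrite sumr_const_nat subn0.
  move=> t _; rewrite indicE mem_set// => s _ /eqP XYs.
  by apply: never; exists s.
by apply/cvg_lim => //; exact/cvgenyP.
Qed.

Lemma expectation_meeting_time :
  (\int[Pr]_w meeting_time X Y w =\sum_(t <oo) Pr (apart X Y 0 t.+1))%E.
Proof.
under eq_integral do rewrite meeting_time_nneseries.
rewrite integral_nneseries//; last first.
  by move=> t; apply/measurable_realfun.measurable_EFinP;
    exact/measurable_realfun.measurable_indic/measurable_apart.
apply: eq_eseriesr => t _; rewrite integral_indic// ?setIT//.
exact: measurable_apart.
Qed.

End Pair.
End Probability.

(** * Bilinear forms of the inverse and singular values *)

(** By Lagrange's identity, twice the difference of the two sides is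
[\sum_i \sum_j (a i * b j - a j * b i) ^+ 2]. *)
Lemma CauchySchwarz_sum (R : realFieldType) (I : finType) (a b : I -> R) :
  (\sum_i a i * b i) ^+ 2 <= (\sum_i a i ^+ 2) * (\sum_i b i ^+ 2).
Proof.
have H : 0 <= \sum_i \sum_j (a i * b j - a j * b i) ^+ 2.
  by apply: sumr_ge0 => i _; apply: sumr_ge0 => j _; exact: sqr_ge0.
suff E : \sum_i \sum_j (a i * b j - a j * b i) ^+ 2 =
    ((\sum_i a i ^+ 2) * (\sum_i b i ^+ 2) - (\sum_i a i * b i) ^+ 2) *+ 2.
  by move: H; rewrite E pmulrn_lge0// subr_ge0.
pose f i j := a i ^+ 2 * b j ^+ 2 - a i * b i * (a j * b j).
rewrite (eq_bigr (fun i => \sum_j f i j + \sum_j f j i)) => [|i _]; last first.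
  by rewrite -big_split /=; apply: eq_bigr => j _; rewrite /f; ring.
rewrite big_split /= [X in _ + X]exchange_big /= -mulr2n; congr (_ *+ 2).
rewrite expr2 !mulr_suml -sumrB; apply: eq_bigr => i _.
by rewrite !mulr_sumr -sumrB.
Qed.

Section SVD.
Context (R : realType) (m : nat).
Implicit Types (A U V : 'M[R]_m) (sigma : 'rV[R]_m) (x y : 'cV[R]_m).

Lemma enorm_sqr x : enorm x ^+ 2 = \sum_i x i 0 ^+ 2.
Proof. by rewrite sqr_sqrtr// sumr_ge0// => i _; exact: sqr_ge0. Qed.

Lemma enorm_ge0 x : 0 <= enorm x. Proof. exact: sqrtr_ge0. Qed.

Lemma enorm_orthogonal V x : V *m V^T = 1%:M -> enorm (V^T *m x) = enorm x.
Proof.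
have dot z : (z^T *m z) 0 0 = \sum_i z i 0 ^+ 2 :> R.
  by rewrite mxE; apply: eq_bigr => i _; rewrite mxE expr2.
by move=> VV; rewrite /enorm -!dot trmx_mul trmxK mulmxA -(mulmxA x^T) VV mulmx1.
Qed.

Lemma is_svd_inv A U sigma V :
  is_svd A U sigma V -> (forall i, 0 < sigma 0 i) ->
  A *m (V *m diag_mx (map_mx GRing.inv sigma) *m U^T) = 1%:M.
Proof.
case=> -[_ UU] [VV _] _ _ -> s0.
rewrite !mulmxA -(mulmxA _ V^T V) VV mulmx1 -(mulmxA U) mulmx_diag.
rewrite (_ : \row_ _ _ = const_mx 1) ?diag_const_mx ?mulmx1//.
by apply/rowP => i; rewrite !mxE mulfV// gt_eqF.
Qed.

Lemma is_svd_unitmx A U sigma V :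
  is_svd A U sigma V -> (forall i, 0 < sigma 0 i) -> A \in unitmx.
Proof. by move=> svd /(is_svd_inv svd)/mulmx1_unit []. Qed.

Lemma is_svd_invmx A U sigma V :
  is_svd A U sigma V -> (forall i, 0 < sigma 0 i) ->
  invmx A = V *m diag_mx (map_mx GRing.inv sigma) *m U^T.
Proof.
move=> svd s0; rewrite -[RHS](mulKmx (is_svd_unitmx svd s0)).
by rewrite (is_svd_inv svd s0) mulmx1.
Qed.

Lemma singular_pair_form U V x y i :
  (x^T *m col i V *m (col i U)^T *m y) 0 0 = (V^T *m x) i 0 * (U^T *m y) i 0.
Proof.
have -> : x^T *m col i V *m (col i U)^T *m y =
    (x^T *m col i V) *m ((col i U)^T *m y) by rewrite !mulmxA.
rewrite mxE big_ord1; congr (_ * _); rewrite !mxE; apply: eq_bigr => j _.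
  by rewrite !mxE mulrC.
by rewrite !mxE.
Qed.

Lemma is_svd_form A U sigma V x y :
  is_svd A U sigma V -> (forall i, 0 < sigma 0 i) ->
  (x^T *m invmx A *m y) 0 0 =
  \sum_i (sigma 0 i)^-1 * (x^T *m col i V *m (col i U)^T *m y) 0 0.
Proof.
move=> svd s0; rewrite (is_svd_invmx svd s0).
have -> D : x^T *m (V *m D *m U^T) *m y = (V^T *m x)^T *m D *m (U^T *m y).
  by rewrite trmx_mul trmxK !mulmxA.
rewrite mul_mx_diag mxE; apply: eq_bigr => i _.
by rewrite singular_pair_form !mxE mulrCA mulrA.
Qed.

(** Each [(sigma 0 i)^-1] with [i <= j] is at most [(sigma 0 j)^-1] because the
singular values decrease. The remaining sum of products of coordinates in the
bases [V] and [U], taken in absolute value and extended to all indices, is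
bounded by Cauchy-Schwarz, and orthogonal changes of basis preserve norms. *)
Lemma is_svd_head_bound A U sigma V x y (j : 'I_m) :
  is_svd A U sigma V -> (forall i, 0 < sigma 0 i) ->
  `|\sum_(i < m | (i <= j)%N)
      (sigma 0 i)^-1 * (x^T *m col i V *m (col i U)^T *m y) 0 0| <=
  enorm x * enorm y / sigma 0 j.
Proof.
move=> [[_ UU] [_ VV] _ s_mono _] s0.
rewrite -(enorm_orthogonal x VV) -(enorm_orthogonal y UU).
set a := V^T *m x; set b := U^T *m y.
have CS : \sum_i `|a i 0| * `|b i 0| <= enorm a * enorm b.
  rewrite -ler_sqr ?nnegrE; [|by apply: sumr_ge0 => i _; exact: mulr_ge0|
    by rewrite mulr_ge0 ?enorm_ge0].
  rewrite exprMn !enorm_sqr (le_trans (CauchySchwarz_sum _ _))//.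
  by under eq_bigr do rewrite real_normK ?num_real//;
     under [X in _ * X]eq_bigr do rewrite real_normK ?num_real//.
apply: (le_trans (ler_norm_sum _ _ _)).
rewrite ler_pdivlMr// mulr_suml; apply: le_trans CS.
rewrite big_mkcond; apply: ler_sum => i _; case: ifPn => [ij|_]; last first.
  by rewrite mulr_ge0.
rewrite singular_pair_form !normrM mulrAC ler_piMl ?mulr_ge0//.
rewrite gtr0_norm ?invr_gt0// mulrC ler_pdivrMr// mul1r.
exact: s_mono.
Qed.

End SVD.

(** * The stationary meeting time as a resolvent value *)

Section Chain.
Context (R : realType) (n : nat) (P : 'M[R]_n).

Lemma LkillE : Lkill P = 1%:M - killed P. Proof. by []. Qed.

Lemma offdiag_mulE (v : 'cV[R]_(n * n)) i j :
  (offdiag_mx R n *m v) (mxtens_index (i, j)) 0 =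
  (i != j)%:R * v (mxtens_index (i, j)) 0.
Proof.
rewrite mxE (bigD1 (mxtens_index (i, j)))//= big1 ?addr0 => [|b bij].
  by rewrite !mxE eqxx mxtens_indexK.
by rewrite !mxE eq_sym (negPf bij) mul0r.
Qed.

Lemma killed_ge0 : stochastic P -> forall a b, 0 <= killed P a b.
Proof.
case=> P01 _ a b; case: (mxtens_indexP b) => k l; rewrite killedE !mulr_ge0//.
- by case/andP: (P01 (mxtens_unindex a).1 k).
- by case/andP: (P01 (mxtens_unindex a).2 l).
Qed.

Lemma killed_le1 : stochastic P -> forall a, \sum_b killed P a b <= 1.
Proof.
case=> P01 P1 a; rewrite sum_mxtens_index.
rewrite -(P1 (mxtens_unindex a).1); apply: ler_sum => k _.
rewrite -[leRHS]mulr1 -(P1 (mxtens_unindex a).2) mulr_sumr.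
apply: ler_sum => l _; rewrite killedE ler_piMr//; last by case: (_ != _).
have /andP[? _] := P01 (mxtens_unindex a).1 k.
by have /andP[? _] := P01 (mxtens_unindex a).2 l; exact: mulr_ge0.
Qed.

Lemma mean_meeting_timeE i j (c : chain_pair P i j) :
  stochastic P -> Lkill P \in unitmx ->
  mean_meeting_time c =
    ((offdiag_mx R n *m (invmx (Lkill P) *m const_mx 1) : 'cV[R]_(n * n))
       (mxtens_index (i, j)) 0)%:E.
Proof.
move=> hP hL; rewrite offdiag_mulE.
rewrite /mean_meeting_time (expectation_meeting_time (cp_markovX c) (cp_markovY c)).
under eq_eseriesr do rewrite (probability_apart (cp_markovX c) (cp_markovY c)
  (@cp_indep _ _ _ _ _ c)).
have [ij|ij] := eqVneq i j; first by rewrite eseries0 ?mul0r// => t _ _; rewrite mul0r.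
under eq_eseriesr do rewrite mul1r.
by rewrite mul1r survival_nneseries//; [exact: killed_ge0|exact: killed_le1].
Qed.

Context (pi : 'cV[R]_n).
Local Notation rho := (pi *t pi : 'cV[R]_(n * n)).

Lemma tens_colE i j : rho (mxtens_index (i, j)) 0 = pi i 0 * pi j 0.
Proof. by rewrite mxE mxtens_indexK !ord1. Qed.

Lemma enorm_tens : enorm rho = enorm pi ^+ 2.
Proof.
apply/eqP; rewrite -(eqrXn2 (n := 2))// ?exprn_ge0 ?enorm_ge0//.
rewrite !enorm_sqr (sum_mxtens_index (n:=n)) expr2 mulr_suml.
apply/eqP/eq_bigr => i _; rewrite mulr_sumr; apply: eq_bigr => j _.
by rewrite tens_colE exprMn.
Qed.

Lemma tens_stationary : stationary P pi -> rho^T *m (P *t P) = rho^T.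
Proof.
case=> _ _ /matrixP piP; apply/matrixP => z a; rewrite ord1.
case: (mxtens_indexP a) => k l.
rewrite mxE (sum_mxtens_index (n := n)) [RHS]mxE tens_colE.
have piE c : \sum_i pi i 0 * P i c = pi c 0.
  by have := piP 0 c; rewrite !mxE => <-; apply: eq_bigr => i _; rewrite mxE.
rewrite -(piE k) -(piE l) mulr_suml; apply: eq_bigr => i _.
rewrite mulr_sumr; apply: eq_bigr => j _.
by rewrite tensmxE [rho^T _ _]mxE tens_colE mulrACA.
Qed.

Lemma tens_sum1 : stationary P pi -> (rho^T *m const_mx 1 : 'M[R]_1) 0 0 = 1.
Proof.
case=> _ pi1 _; rewrite mxE sum_mxtens_index.
transitivity ((\sum_i pi i 0) * (\sum_i pi i 0)); last by rewrite pi1 mulr1.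
rewrite mulr_suml; apply: eq_bigr => i _.
rewrite mulr_sumr; apply: eq_bigr => j _.
by rewrite [rho^T _ _]mxE tens_colE mxE mulr1.
Qed.

(** Stationarity gives [rho^T Lkill = rho^T - rho^T E], where [E] is
[offdiag_mx R n]. Applied to the resolvent vector [r], which [Lkill] maps to the
all-ones vector, this reads [1 = rho^T r - rho^T E r], and [rho^T E r] is the
[rho]-average of the mean meeting times. *)
Lemma t_meetE (C : forall i j, chain_pair P i j) :
  stochastic P -> stationary P pi -> Lkill P \in unitmx ->
  t_meet pi C = (-1 + (rho^T *m invmx (Lkill P) *m const_mx 1 : 'M[R]_1) 0 0)%:E.
Proof.
move=> hP hpi hL; set r : 'cV[R]_(n * n) := invmx (Lkill P) *m const_mx 1.
have Lr : Lkill P *m r = const_mx 1 by rewrite mulKVmx.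
have -> : t_meet pi C = ((rho^T *m (offdiag_mx R n *m r)) 0 0)%:E.
  rewrite /t_meet mxE sum_mxtens_index -sumEFin; apply: eq_bigr => i _.
  rewrite -sumEFin; apply: eq_bigr => j _.
  by rewrite mean_meeting_timeE// [rho^T _ _]mxE tens_colE.
have rhoL : rho^T *m const_mx 1 =
    rho^T *m r - rho^T *m (offdiag_mx R n *m r) :> 'M[R]_1.
  by rewrite -Lr LkillE mulmxBl mul1mx mulmxBr !mulmxA tens_stationary.
have := tens_sum1 hpi; rewrite rhoL [LHS]mxE [in X in _ + X]mxE.
by move/eqP; rewrite -mulmxA subr_eq => /eqP ->; rewrite addKr.
Qed.

End Chain.

Lemma enorm_const1 (R : realType) n : enorm (const_mx 1 : 'cV[R]_(n * n)) = n%:R.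
Proof.
rewrite /enorm; under eq_bigr do rewrite mxE expr1n.
by rewrite sumr_const card_ord natrM -expr2 sqrtr_sqr ger0_norm.
Qed.

(** * The truncation error *)

(* [rev_ord k] has value [n * n - k - 1], so [sigma 0 (rev_ord k)] is the
   (n^2-k)-th largest singular value. *)
Theorem proposition1p2 (R : realType) (n : nat) (hn : (2 <= n)%N)
    (P : 'M[R]_n) (hP : stochastic P) (hirr : irreducible_chain P)
    (pi : 'cV[R]_n) (hpi : stationary P pi)
    (C : forall i j : 'I_n, chain_pair P i j)
    (U : 'M[R]_(n * n)) (sigma : 'rV[R]_(n * n)) (V : 'M[R]_(n * n))
    (hsvd : is_svd (Lkill P) U sigma V) (hpos : forall i, 0 < sigma 0 i)
    (k : 'I_(n * n)) (hk : (0 < k)%N) :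
  (`| (t_meet_hat pi U sigma V k)%:E - t_meet pi C |
     <= (n%:R * enorm pi ^+ 2 / sigma 0 (rev_ord k))%:E)%E.
Proof.
rewrite (t_meetE C hP hpi (is_svd_unitmx hsvd hpos)).
rewrite (is_svd_form _ _ hsvd hpos) /t_meet_hat.
rewrite [X in (-1 + X)%:E](bigID (fun i : 'I_(n * n) => (n * n - k <= i)%N)) /=.
rewrite lee_fin addrA opprD addrA subrr sub0r normrN.
have headP i : ~~ (n * n - k <= i)%N = (i <= rev_ord k)%N.
  by rewrite -ltnNge -[RHS]ltnS /= subnSK.
under eq_bigl do rewrite headP.
apply: le_trans (is_svd_head_bound _ _ _ hsvd hpos) _.
by rewrite enorm_tens enorm_const1 (mulrC n%:R).
Qed.
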